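(* Let $R$ be a commutative ring, and $P^\bullet$ a bounded below cochain complex of finitely generated projective $R$-modules. If $P^\bullet$ is acyclic, then it is chain contractible.
   Context: A cochain complex $P^\bullet$ (differentials $d^n\colon P^n\to P^{n+1}$) is bounded below if $P^n=0$ for $n\ll0$; it may be unbounded above. Acyclic means all cohomology modules vanish. $R$ is not assumed noetherian. *)

(* Defs.v *)
From mathcomp Require Import all_boot all_order all_algebra.

Set Implicit Arguments.
Unset Strict Implicit.
Unset Printing Implicit Defensive.

Import GRing.Theory.
Local Open Scope ring_scope.

(* comPzRingType rather than comNzRingType: the zero ring is allowed. *)

Definition finitely_generated (R : comPzRingType) (M : lmodType R) : Prop :=
  exists (n : nat) (e : 'I_n -> M),
    forall x : M, exists c : 'I_n -> R, x = \sum_(i < n) c i *: e i.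

Definition projective (R : comPzRingType) (M : lmodType R) : Prop :=
  forall (A B : lmodType R) (f : {linear A -> B}) (g : {linear M -> B}),
    (forall b : B, exists a : A, f a = b) ->
    exists h : {linear M -> A}, forall x : M, f (h x) = g x.

Record cochain_complex (R : comPzRingType) := CochainComplex {
  cochain :> int -> lmodType R;
  diff : forall n : int, {linear cochain n -> cochain (n + 1)};
  diff_diff : forall (n : int) (x : cochain n), diff (n + 1) (diff n x) = 0
}.

Definition bounded_below (R : comPzRingType) (P : cochain_complex R) : Prop :=
  exists N : int, forall n : int, n < N -> forall x : P n, x = 0.

(* The types P (n - 1 + 1) and P n are not convertible, so the conditions in
   degree m are stated in degree m = n + 1; since n ranges over all of int,
   every degree is covered. *)

Definition cocycle (R : comPzRingType) (P : cochain_complex R) (n : int)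
    (x : P n) : Prop :=
  diff P n x = 0.

Definition coboundary (R : comPzRingType) (P : cochain_complex R) (n : int)
    (x : P (n + 1)) : Prop :=
  exists y : P n, diff P n y = x.

(* Vanishing of the quotient cocycles / coboundaries in every degree. *)
Definition acyclic (R : comPzRingType) (P : cochain_complex R) : Prop :=
  forall (n : int) (x : P (n + 1)), cocycle x -> coboundary x.

(* The identity is null-homotopic: d h + h d = id in every degree, where
   h n is the component P^(n+1) -> P^n of the homotopy. *)
Definition contractible (R : comPzRingType) (P : cochain_complex R) : Prop :=
  exists h : forall n : int, {linear P (n + 1) -> P n},
    forall (n : int) (x : P (n + 1)),
      diff P n (h n x) + h (n + 1) (diff P (n + 1) x) = x.

(* Main.v *)
Require Import Defs.
From HB Require Import structures.
From mathcomp Require Import all_boot all_order all_algebra.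
From Stdlib Require Import IndefiniteDescription.

Set Implicit Arguments.
Unset Strict Implicit.
Unset Printing Implicit Defensive.

Import Order.TTheory GRing.Theory Num.Theory.
Local Open Scope ring_scope.

(** The differentials are split one degree at a time, from the bottom up.
    Suppose that a projection [e] of [P n] onto its cocycles is known; it
    suffices to find [h : P (n + 1) -> P n] with [h d = 1 - e], because then
    [d h] projects [P (n + 1)] onto its cocycles ([cocycle_projectionS]).
    Below the bound of the complex the identity is such a projection, so one
    exists in every degree, and the maps [h n \o e (n + 1)] form a
    contraction.

    To find [h], write [P n] as a retract of a free module [F], with inclusion
    [i] and retraction [p], and let [q x = i (x - e x)].  The map
    [f v = (d (p v), v - q (p v))] from [F] to [P (n + 1) * F] is injective,
    and a left inverse of [f] yields [h] ([splitting]).  A map out of a free module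
    has a left inverse as soon as it sends unimodular vectors to unimodular
    vectors ([left_inverse_of_unimodular]).  So let [v] be unimodular and let
    [a] be the finite list of coordinates of [f v]; the claim is that [a]
    generates the unit ideal.

    This is where exactness in all the higher degrees is used.  If the ideal of
    [a] were proper, it would have infinite grade: [f] remains injective after
    dividing by any regular sequence, since the complex remains exact, so that
    another regular element, generic in the ideal, always exists.  But a proper
    ideal with [m] generators has grade at most [m].  Both halves are made
    elementary by working with the module [T] of functions
    ['I_m ^ m -> R], the [m]-th tensor power of [R ^ m].  The vector [a],
    placed in the tensor factor [i], plays the role of the [i]-th regular
    element, and [tensor_rel a S] is the submodule generated by these
    relations for [i] in [S].  Adding the factors to [S] one by one preserves
    exactness modulo [tensor_rel a S] ([cocycles_liftU1]), and this in turn
    makes [a] regular modulo [tensor_rel a S].  Now the determinant tensor is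
    multiplied by each [a j] into the relations, by Cramer's rule
    ([tensor_rel_det]), hence it is itself a relation when [S] is everything.
    Its coordinate at the identity is [1], whereas the coordinates of a
    relation lie in the ideal of [a] ([unit_ideal]). *)

Lemma linear_ex (R : pzRingType) (M N : lmodType R) (f : M -> N) :
  linear f -> exists F : {linear M -> N}, forall x, F x = f x.
Proof.
move=> lin_f; pose L := GRing.isLinear.Build R M N *:%R f lin_f.
by exists (HB.pack_for {linear M -> N} f L).
Qed.

(** * Relations in a tensor power *)

Section TensorRelations.

Variables (R : comPzRingType) (m : nat) (a : 'I_m -> R).
Implicit Types (M N : lmodType R) (S : {set 'I_m}).

Notation index := {ffun 'I_m -> 'I_m}.

(** An element of [index] is a multi-index of the [m]-fold tensor power of
    [R ^ m]; a tensor with coefficients in [M] is its family of coordinates,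
    that is, a function [index -> M]. *)
Definition update (w : index) (i j : 'I_m) : index :=
  [ffun l => if l == i then j else w l].

Lemma update_update w i j j' : update (update w i j) i j' = update w i j'.
Proof. by apply/ffunP=> l; rewrite !ffunE; case: eqP. Qed.

Lemma update_comm w i i' j j' : i != i' ->
  update (update w i j) i' j' = update (update w i' j') i j.
Proof.
move=> ne_i; apply/ffunP=> l; rewrite !ffunE; case: (l =P i') => [->|//].
by rewrite eq_sym (negPf ne_i).
Qed.

Lemma update_id w i : update w i (w i) = w.
Proof. by apply/ffunP=> l; rewrite ffunE; case: eqP => [->|]. Qed.

Definition free_of M (i : 'I_m) (f : index -> M) : Prop :=
  forall w j, f (update w i j) = f w.

(** Sums, over [i] in [S], of tensors having the vector [a] as their [i]-th
    factor; the remaining factors, and the coefficient in [M], are gathered in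
    [g i]. *)
Definition tensor_rel M S (f : index -> M) : Prop :=
  exists2 g : 'I_m -> index -> M, (forall i, free_of i (g i))
    & forall w, f w = \sum_(i in S) a (w i) *: g i w.

Lemma eq_tensor_rel M S (f f' : index -> M) :
  f =1 f' -> tensor_rel S f -> tensor_rel S f'.
Proof. by move=> eq_f [g gP fE]; exists g => // w; rewrite -eq_f. Qed.

Lemma tensor_rel_set0 M (f : index -> M) : tensor_rel set0 f -> forall w, f w = 0.
Proof. by move=> [g _ fE] w; rewrite fE big_set0. Qed.

Lemma tensor_rel0 M S : tensor_rel S (fun=> 0 : M).
Proof.
exists (fun _ _ => 0) => // w.
by rewrite big1 // => i _; rewrite scaler0.
Qed.

Lemma tensor_relD M S (f g : index -> M) :
  tensor_rel S f -> tensor_rel S g -> tensor_rel S (fun w => f w + g w).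
Proof.
move=> [f' f'P fE] [g' g'P gE]; exists (fun i w => f' i w + g' i w).
  by move=> i w j; rewrite f'P g'P.
by move=> w; rewrite fE gE -big_split; apply: eq_bigr => i _; rewrite scalerDr.
Qed.

Lemma tensor_rel_sum M S (I : finType) (f : I -> index -> M) :
  (forall i, tensor_rel S (f i)) -> tensor_rel S (fun w => \sum_i f i w).
Proof.
move=> fP; elim: (index_enum I) => [|i r IHr].
  by apply: eq_tensor_rel (tensor_rel0 M S) => w; rewrite big_nil.
by apply: eq_tensor_rel (tensor_relD (fP i) IHr) => w; rewrite big_cons.
Qed.

Lemma tensor_rel_linear M N S (h : {linear M -> N}) (f : index -> M) :
  tensor_rel S f -> tensor_rel S (fun w => h (f w)).
Proof.
move=> [g gP fE]; exists (fun i w => h (g i w)).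
  by move=> i w j; rewrite gP.
by move=> w; rewrite fE linear_sum; apply: eq_bigr => i _; rewrite linearZ.
Qed.

Lemma tensor_rel_scale M S k (f : index -> M) : k \notin S ->
  tensor_rel S f -> tensor_rel S (fun w => a (w k) *: f w).
Proof.
move=> kS [g gP fE].
exists (fun i (w : index) => if i == k then 0 else a (w k) *: g i w).
  move=> i w j; case: eqP => // /eqP ik.
  by rewrite gP ffunE eq_sym (negPf ik).
move=> w; rewrite fE scaler_sumr; apply: eq_bigr => i iS.
case: eqP => [ik|_]; first by rewrite -ik iS in kS.
by rewrite !scalerA mulrC.
Qed.

Lemma tensor_rel_update M S k j (f : index -> M) : k \notin S ->
  tensor_rel S f -> tensor_rel S (fun w : index => f (update w k j)).
Proof.
move=> kS [g gP fE].
exists (fun i (w : index) => if i == k then 0 else g i (update w k j)).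
  move=> i w l; case: eqP => // /eqP ik.
  by rewrite update_comm // gP.
move=> w; rewrite fE; apply: eq_bigr => i iS.
case: eqP => [ik|/eqP ik]; first by rewrite -ik iS in kS.
by rewrite ffunE (negPf ik).
Qed.

Lemma tensor_relU1 M S k (f g : index -> M) : k \notin S ->
  tensor_rel S f -> free_of k g ->
  tensor_rel (k |: S) (fun w => f w + a (w k) *: g w).
Proof.
move=> kS [f' f'P fE] gP; exists (fun i => if i == k then g else f' i).
  by move=> i; case: eqP => [->|].
move=> w; rewrite big_setU1 //= eqxx addrC fE; congr (_ + _).
apply: eq_bigr => i iS.
by case: eqP => [ik|//]; rewrite -ik iS in kS.
Qed.

Lemma tensor_relU1_inv M S k (f : index -> M) : k \notin S ->
  tensor_rel (k |: S) f -> exists2 g, free_of k g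
    & tensor_rel S (fun w => f w - a (w k) *: g w).
Proof.
move=> kS [g gP fE]; exists (g k) => //; exists g => // w.
by rewrite fE big_setU1 //= [LHS]addrC addKr.
Qed.

(** The determinant tensor is the antisymmetrization of [e_1 * ... * e_m].
    Each of its coordinates is the determinant of a 0-1 matrix [X] with
    [X a = (a (w i))_i], so multiplying by [\adj X] gives [a j * \det X] as a
    combination of the [a (w i)]; the coefficient of [a (w i)] is a cofactor
    along row [i], and therefore does not depend on [w i]. *)
Lemma tensor_rel_det j : tensor_rel (M := R^o) setT
  (fun w => a j * \det (\matrix_(i, l) (w i == l)%:R : 'M_m)).
Proof.
pose X (w : index) : 'M[R]_m := \matrix_(i, l) (w i == l)%:R.
exists (fun i w => \adj (X w) j i).
  move=> i w l; rewrite !mxE /cofactor; congr (_ * \det _).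
  apply/matrixP=> p q; rewrite !mxE ffunE.
  by rewrite [_ == i]eq_sym (negPf (neq_lift _ _)).
move=> w; have := congr1 (fun A => (A *m \col_i a i) j 0) (mul_adj_mx (X w)).
rewrite -mulmxA mul_scalar_mx !mxE mulrC => <-.
rewrite [RHS]big_mkcond; apply: eq_bigr => i _; rewrite inE.
rewrite !mxE (bigD1 (w i)) //= big1 => [|l ne_l].
  by rewrite !mxE eqxx mul1r addr0 mulrC.
by rewrite !mxE eq_sym (negPf ne_l) mul0r.
Qed.

End TensorRelations.

(** * Retracts of free modules *)

Section Retracts.

Variable R : comPzRingType.
Implicit Types M N : lmodType R.

Lemma fgproj_retract M : finitely_generated M -> projective M ->
  exists k (i : {linear M -> 'rV[R]_k}) (p : {linear 'rV[R]_k -> M}),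
    cancel i p.
Proof.
move=> [k [e eP]] projM.
have [|p pE] := @linear_ex R 'rV[R]_k M (fun v => \sum_l v 0 l *: e l).
  move=> c u v; rewrite scaler_sumr -big_split; apply: eq_bigr => l _.
  by rewrite !mxE scalerDl scalerA.
have [x|i iP] := projM _ _ p (idfun : {linear M -> M}); last by exists k, i, p.
have [c ->] := eP x; exists (\row_l c l).
by rewrite pE; apply: eq_bigr => l _; rewrite mxE.
Qed.

Lemma retract_pair M N k k' (i : {linear M -> 'rV[R]_k})
    (p : {linear 'rV[R]_k -> M}) (i' : {linear N -> 'rV[R]_k'})
    (p' : {linear 'rV[R]_k' -> N}) : cancel i p -> cancel i' p' ->
  exists (j : {linear (M * N)%type -> 'rV[R]_(k + k')})
         (q : {linear 'rV[R]_(k + k') -> (M * N)%type}), cancel j q.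
Proof.
move=> iK i'K.
have [|j jE] := @linear_ex R (M * N)%type 'rV[R]_(k + k')
    (fun x => row_mx (i x.1) (i' x.2)).
  by move=> c [x1 x2] [y1 y2] /=; rewrite !linearP scale_row_mx add_row_mx.
have [|q qE] := @linear_ex R 'rV[R]_(k + k') (M * N)%type
    (fun v => (p (lsubmx v), p' (rsubmx v))).
  by move=> c u v; rewrite !linearP.
by exists j, q => -[x y]; rewrite qE jE row_mxKl row_mxKr iK i'K.
Qed.

(** Membership in the relations may be tested on the coordinates of a free
    module that retracts onto [M]. *)
Lemma tensor_rel_coord m (a : 'I_m -> R) S M k (i : {linear M -> 'rV[R]_k})
    (p : {linear 'rV[R]_k -> M}) (f : {ffun 'I_m -> 'I_m} -> M) :
  cancel i p ->
  (forall l, tensor_rel (M := R^o) a S (fun w => i (f w) 0 l)) ->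
  tensor_rel a S f.
Proof.
move=> iK fP.
have [c cE] : exists c : 'I_k -> {linear R^o -> M},
    forall l x, c l x = p (x *: delta_mx 0 l).
  have /fin_all_exists[c cE] l : exists c : {linear R^o -> M},
      forall x, c x = p (x *: delta_mx 0 l).
    by apply: linear_ex => b x y; rewrite scalerDl -scalerA linearP.
  by exists c.
have := tensor_rel_sum (fun l => tensor_rel_linear (c l) (fP l)).
apply: eq_tensor_rel => w; rewrite -[RHS]iK [in RHS](row_sum_delta (i (f w))).
by rewrite linear_sum; apply: eq_bigr => l _; rewrite cE.
Qed.

End Retracts.

(** * Left inverses of maps that preserve unimodular vectors *)

Section LeftInverse.

Variable R : comPzRingType.

(** A left inverse is built on one basis vector after another, as in
    Villamayor's lemma on pure submodules of free modules.  If [h] inverts [f]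
    on the first [n] basis vectors, its truncation [t] to their span still
    does.  The defect [x] of [t] at the next basis vector has a coordinate [1]
    there, so some functional [c] takes the value [1] at [f x], and
    [t y + c (y - f (t y)) *: x] is correct at that vector too. *)
Lemma left_inverse_of_unimodular k (G : lmodType R)
    (f : {linear 'rV[R]_k -> G}) :
  (forall (v : 'rV[R]_k) l, v 0 l = 1 -> exists c : {linear G -> R^o}, c (f v) = 1) ->
  exists h : {linear G -> 'rV[R]_k}, cancel f h.
Proof.
move=> unimod_f.
have /(_ _ (leqnn k))[h hP] n : (n <= k)%N ->
    exists h : {linear G -> 'rV[R]_k},
    forall l : 'I_k, (l < n)%N -> h (f (delta_mx 0 l)) = delta_mx 0 l.
  elim: n => [|n IHn] le_nk.
    by exists (\0 : {linear G -> 'rV[R]_k}).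
  have [h hP] := IHn (ltnW le_nk); pose ln := Ordinal le_nk.
  have [|t tE] := @linear_ex R G 'rV[R]_k
      (fun y => \row_l (if (l < n)%N then h y 0 l else 0)).
    move=> c x y; apply/rowP=> l; rewrite !mxE linearP !mxE.
    by case: ifP; rewrite // mulr0 addr0.
  have tP (l : 'I_k) : (l < n)%N -> t (f (delta_mx 0 l)) = delta_mx 0 l.
    move=> lt_ln; rewrite tE hP //; apply/rowP=> q; rewrite !mxE eqxx /=.
    case: ifP => // /negbT le_nq; case: eqP => // eq_ql.
    by rewrite eq_ql lt_ln in le_nq.
  pose x := delta_mx 0 ln - t (f (delta_mx 0 ln)).
  have [|c cP] := unimod_f x ln.
    by rewrite !mxE tE !mxE !eqxx /= ltnn subr0.
  have [|h' h'E] := @linear_ex R G 'rV[R]_k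
      (fun y => t y + c (y - f (t y)) *: x).
    move=> b y z; have ->: b *: y + z - f (t (b *: y + z))
        = b *: (y - f (t y)) + (z - f (t z)).
      by rewrite [t _]linearP [f _]linearP scalerBr opprD addrACA.
    rewrite [t _]linearP [c _]linearP scalerDl [b *: (_ + _)]scalerDr scalerA !addrA.
    by congr (_ + _); exact: addrAC.
  exists h' => l; rewrite ltnS leq_eqVlt => /predU1P[eq_ln|lt_ln].
    have ->: l = ln by apply/val_inj.
    by rewrite h'E -linearB cP scale1r addrC subrK.
  by rewrite h'E tP // subrr linear0 scale0r addr0.
exists h => v; rewrite {1}[v]row_sum_delta !linear_sum [RHS]row_sum_delta.
by apply: eq_bigr => l _; rewrite !linearZ /= hP.
Qed.

End LeftInverse.

(** * Exactness modulo the relations *)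

Section Complex.

Variables (R : comPzRingType) (P : cochain_complex R).
Hypothesis acycP : acyclic P.
Hypothesis retractP : forall n,
  exists k (i : {linear P n -> 'rV[R]_k}) (p : {linear 'rV[R]_k -> P n}),
    cancel i p.

(** A cochain that is a cocycle modulo the relations is congruent to a
    genuine cocycle.  For an acyclic complex this is exactness of the complex
    modulo the relations; in this form it refers to a single degree. *)
Definition cocycles_lift m (a : 'I_m -> R) (S : {set 'I_m}) : Prop :=
  forall n (v : {ffun 'I_m -> 'I_m} -> P n),
    tensor_rel a S (fun w => diff P n (v w)) ->
  exists2 u, (forall w, diff P n (u w) = 0)
    & tensor_rel a S (fun w => v w - u w).

Definition regular_mod m (a : 'I_m -> R) (S : {set 'I_m}) : Prop :=
  forall z : {ffun 'I_m -> 'I_m} -> R,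
  (forall j, tensor_rel (M := R^o) a S (fun w => a j * z w)) ->
  tensor_rel (M := R^o) a S z.

Lemma cocycles_lift0 m (a : 'I_m -> R) : cocycles_lift a set0.
Proof.
move=> n v /tensor_rel_set0 dv0; exists v => //.
by apply: eq_tensor_rel (tensor_rel0 a _ _) => w; rewrite subrr.
Qed.

(** Regularity on scalars extends to [P n] because [P n] is a retract of a
    free module. *)
Lemma regular_mod_cochain m (a : 'I_m -> R) S n
    (z : {ffun 'I_m -> 'I_m} -> P n) : regular_mod a S ->
  (forall j, tensor_rel a S (fun w => a j *: z w)) -> tensor_rel a S z.
Proof.
move=> regS azP; have [k [i [p iK]]] := retractP n.
apply: (tensor_rel_coord iK) => l; apply: regS => j.
have [|c cE] := @linear_ex R (P n) R^o (fun x => i x 0 l).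
  by move=> b x y; rewrite linearP !mxE.
apply: eq_tensor_rel (tensor_rel_linear c (azP j)) => w.
by rewrite linearZ /= cE.
Qed.

(** The long exact sequence of the division by one more relation, done by
    hand.  If [d v] is [a (w k) *: t w] modulo [S], then [d t] is killed by
    each [a j] modulo [S], hence vanishes modulo [S] by regularity.  So [t] is
    congruent to a cocycle, which is a coboundary [d s'], and
    [v w - a (w k) *: s' w] is a cocycle modulo [S]. *)
Lemma cocycles_liftU1 m (a : 'I_m -> R) (S : {set 'I_m}) k : k \notin S ->
  cocycles_lift a S -> regular_mod a S -> cocycles_lift a (k |: S).
Proof.
move=> kS liftS regS n v /(tensor_relU1_inv kS)[t t_free dvP].
have dtP : tensor_rel a S (fun w => diff P (n + 1) (t w)).
  apply: (regular_mod_cochain regS) => j.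
  (* As [t] is independent of the coordinate [k], setting this coordinate to
     [j] turns the factor [a (w k)] of [t] into [a j]. *)
  have := tensor_rel_update j kS (tensor_rel_linear (diff P (n + 1)) dvP).
  move/(tensor_rel_linear (-%R : {linear P (n + 1 + 1) -> P (n + 1 + 1)})).
  apply: eq_tensor_rel => w /=.
  by rewrite linearB linearZ /= diff_diff sub0r opprK t_free ffunE eqxx.
have [u du0 tuP] := liftS _ _ dtP.
(* The primitive must not depend on the coordinate [k] either; this is achieved
   by fixing that coordinate, here to [k] itself for want of another element
   of ['I_m] at hand. *)
have /fin_all_exists[s sP] w : exists s, diff P n s = u (update w k k).
  exact: acycP (du0 _).
pose s' w := s (update w k k).
have s'P w : diff P n (s' w) = u (update w k k) by rewrite sP update_update.
have s'_free : free_of k s' by move=> w j; rewrite /s' update_update.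
have {}tuP : tensor_rel a S (fun w => t w - diff P n (s' w)).
  apply: eq_tensor_rel (tensor_rel_update k kS tuP) => w.
  by rewrite t_free s'P.
have [|u' du'0 vuP] := liftS n (fun w => v w - a (w k) *: s' w).
  have := tensor_relD dvP (tensor_rel_scale kS tuP).
  apply: eq_tensor_rel => w.
  by rewrite [RHS]linearB [diff P n (_ *: _)]linearZ /= [_ *: (_ - _)]scalerBr addrA subrK.
exists u' => //.
apply: eq_tensor_rel (tensor_relU1 kS vuP s'_free) => w.
by rewrite addrAC subrK.
Qed.

(** The finite form of the bound on the grade of a proper ideal by its number
    of generators. *)
Lemma unit_ideal m (a : 'I_m -> R) :
  (forall S, cocycles_lift a S -> regular_mod a S) ->
  exists b : 'I_m -> R, \sum_j b j * a j = 1.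
Proof.
move=> reg_lift.
have liftP S : cocycles_lift a S.
  elim: {S}_.+1 {-2}S (ltnSn #|S|) => // n IHn S leSn.
  have [->|[k kS]] := set_0Vmem S; first exact: cocycles_lift0.
  have ltSn : (#|S :\ k| < n)%N by move: leSn; rewrite (cardsD1 k S) kS.
  have IH := IHn _ ltSn; rewrite -(setD1K kS).
  by apply: cocycles_liftU1 (IH) (reg_lift _ IH); rewrite setD11.
(* At the identity multi-index the determinant tensor has the coordinate 1. *)
have [g _ /(_ [ffun i => i])] := reg_lift _ (liftP setT) _ (tensor_rel_det a).
set X := (X in \det X); have ->: X = 1%:M.
  by apply/matrixP=> i l; rewrite !mxE ffunE.
rewrite det1 => ->; exists (fun j => g j [ffun i => i]).
rewrite [RHS]big_mkcond; apply: eq_bigr => j _.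
by rewrite inE ffunE mulrC.
Qed.

(** * Splitting the complex *)

Definition cocycle_projection n (e : {linear P n -> P n}) : Prop :=
  (forall x, diff P n (e x) = 0) /\ (forall x, diff P n x = 0 -> e x = x).

(** The second component of [f] compensates for the fact that [P n / ker d] is
    only projective: it is zero on the image of [q], which is a copy of this
    quotient, and it makes [f] injective on the free module. *)
Lemma splitting n (e : {linear P n -> P n}) : cocycle_projection e ->
  exists h : {linear P (n + 1) -> P n}, forall x, h (diff P n x) = x - e x.
Proof.
move=> [de0 eK]; have [k [i [p iK]]] := retractP n.
have [k' [i' [p' i'K]]] := retractP (n + 1).
have eI x : e (x - e x) = 0 by rewrite linearB [e (e x)]eK ?subrr.
have [|q qE] := @linear_ex R (P n) 'rV[R]_k (fun x => i (x - e x)).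
  move=> b x y; rewrite -linearP; congr (i _).
  by rewrite linearP scalerBr opprD addrACA.
have [|f fE] := @linear_ex R 'rV[R]_k (P (n + 1)%R * 'rV[R]_k)%type
    (fun v => (diff P n (p v), v - q (p v))).
  move=> b u v; rewrite [p _]linearP [diff P n _]linearP [q _]linearP; congr (_, _).
  by rewrite /= scalerBr opprD addrACA.
have [|h hP] := left_inverse_of_unimodular (f := f).
  move=> v l vl1.
  have [j [r jK]] := retract_pair i'K
    (fun x => erefl : (idfun : {linear 'rV[R]_k -> 'rV[R]_k}) (idfun x) = x).
  have [|b bP] := @unit_ideal _ (fun s => j (f v) 0 s).
    move=> S liftS z zP.
    have {zP}zfP : tensor_rel (fun s => j (f v) 0 s) S (fun w => z w *: f v).
      apply: (tensor_rel_coord jK) => s; apply: eq_tensor_rel (zP s) => w.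
      by rewrite linearZ mxE mulrC.
    (* If [z] is killed modulo [S] by the coordinates of [f v], then so is
       [z *: v] by [f]: the first component makes [z *: p v] congruent to a
       cocycle, so that [z *: q (p v)] is a relation, and the second component
       gives the same for [z *: (v - q (p v))].  Adding them and taking the
       coordinate equal to 1 recovers [z]. *)
    have /= zdP := tensor_rel_linear fst zfP.
    have [|u du0 zuP] := liftS n (fun w => z w *: p v).
      by apply: eq_tensor_rel zdP => w; rewrite fE linearZ.
    have qu0 w : q (u w) = 0 by rewrite qE eK // subrr linear0.
    have /= zqP := tensor_rel_linear snd zfP.
    have [|c cE] := @linear_ex R 'rV[R]_k R^o (fun x => x 0 l).
      by move=> d x y; rewrite !mxE.
    have := tensor_rel_linear c (tensor_relD zqP (tensor_rel_linear q zuP)).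
    apply: eq_tensor_rel => w; rewrite fE [q (_ - _)]linearB qu0 subr0 [q (_ *: _)]linearZ /=.
    by rewrite -scalerDr subrK cE !mxE vl1 mulr1.
  have [|c cE] := @linear_ex R (P (n + 1)%R * 'rV[R]_k)%type R^o
      (fun y => \sum_s b s * j y 0 s).
    move=> d x y; rewrite /= scaler_sumr -big_split; apply: eq_bigr => s _.
    by rewrite linearP !mxE mulrDr !mulrA [b s * d]mulrC -mulrA.
  by exists c; rewrite cE.
have [|h' h'E] := @linear_ex R (P (n + 1)) (P n)
    (fun y => let x := p (h (y, 0)) in x - e x).
  move=> b x y /=; have ->: (b *: x + y, 0) = b *: (x, 0) + (y, 0)
      :> (P (n + 1)%R * 'rV[R]_k)%type.
    by congr (_, _); rewrite /= scaler0 addr0.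
  by rewrite [h _]linearP [p _]linearP [e _]linearP scalerBr opprD addrACA.
exists h' => x; have pqx : p (q x) = x - e x by rewrite qE iK.
have qqx : q (x - e x) = q x by rewrite !qE eI subr0.
have := hP (q x); rewrite fE pqx qqx subrr linearB de0 subr0 h'E /= => ->.
by rewrite pqx eI subr0.
Qed.

Lemma cocycle_projectionS n : (exists e, @cocycle_projection n e) ->
  exists e, @cocycle_projection (n + 1) e.
Proof.
move=> [e eP]; have [h hP] := splitting eP; have [de0 eK] := eP.
exists (diff P n \o h); split=> [x|x dx0] /=; first exact: diff_diff.
have [y <-] := acycP dx0.
by rewrite hP linearB de0 subr0.
Qed.

Hypothesis bddP : bounded_below P.

Lemma cocycle_projection_ex n : exists e, @cocycle_projection n e.
Proof.
have [N NP] := bddP; have [/NP P0|] := ltP n N.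
  by exists idfun; split=> // x; rewrite [x]P0 linear0.
rewrite -subr_ge0 -[n](subrK N) addrK; case: (n - N) => // k _.
(* The bound gives degrees below [N], and degree [N] is one step above. *)
elim: k => [|k IHk]; last first.
  by rewrite -addn1 PoszD addrAC; apply: cocycle_projectionS.
rewrite add0r -(subrK 1 N); apply: cocycle_projectionS.
exists idfun; split=> // x.
by rewrite [x](NP (N - 1)) ?linear0 // ltrBlDr ltrDl.
Qed.

Lemma contractible_of_retract : contractible P.
Proof.
pose e n := proj1_sig (constructive_indefinite_description _
  (cocycle_projection_ex n)).
have eP n : cocycle_projection (e n) by apply: proj2_sig.
have /(fun H n => constructive_indefinite_description _ (H n)) hP n :
    exists h : {linear P (n + 1) -> P n},
      (forall x, h (diff P n x) = x - e n x)
      /\ (forall x, diff P n (h x) = e (n + 1) x).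
  have [h hP] := splitting (eP n).
  have [de0 eK] := eP (n + 1); have [de0' _] := eP n.
  exists (h \o e (n + 1)); split=> x /=.
    by rewrite eK ?hP // diff_diff.
  have [y <-] := acycP (de0 x).
  by rewrite hP linearB de0' subr0.
exists (fun n => sval (hP n)) => n x.
case: (svalP (hP n)) => _ ->; case: (svalP (hP (n + 1))) => -> _.
by rewrite [LHS]addrC subrK.
Qed.

End Complex.

Theorem theoremA1 (R : comPzRingType) (P : cochain_complex R)
    (hfg : forall n : int, finitely_generated (P n))
    (hproj : forall n : int, projective (P n))
    (hbdd : bounded_below P)
    (hacyc : acyclic P) :
  contractible P.
Proof.
apply: contractible_of_retract => // n.
exact: fgproj_retract (hfg n) (hproj n).
Qed.
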